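(* Let $L\in\mathcal{L}(\mathcal{H})$, where $\mathcal{H}$ is a Hilbert space. Assume that $\mathcal{H}=\mathcal{H}_1\oplus\cdots\oplus\mathcal{H}_d$ (orthogonal direct sum of closed subspaces), and let $E_1,\dots,E_d$ be the orthogonal projections of $\mathcal{H}$ onto the summands $\mathcal{H}_1,\dots,\mathcal{H}_d$. Suppose that $n=n_1+\cdots+n_d$ for some nonnegative integers $n_1,\dots,n_d$. Assume that $n\ge 2$, and set $$K=\sum E_{j_1}LE_{j_2}L\cdots E_{j_{n-1}}LE_{j_n},$$ where the summation is over all distinct arrangements $(j_1,j_2,\dots,j_n)$ of the tuple $$(\,\underbrace{1,\dots,1}_{n_1},\underbrace{2,\dots,2}_{n_2},\dots,\underbrace{d,\dots,d}_{n_d}\,).$$ Then $$\|K\|\le\|L\|^{n-1}.$$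
   Context: $\mathcal{L}(\mathcal{H})$ denotes the bounded linear operators on $\mathcal{H}$, and norms are operator norms. The sum has $\frac{n!}{n_1!n_2!\cdots n_d!}$ terms, one for each tuple $(j_1,\dots,j_n)\in\{1,\dots,d\}^n$ in which the value $i$ occurs exactly $n_i$ times, $i=1,\dots,d$. *)

(* Defs.v *)
From HB Require Import structures.
From mathcomp Require Import all_boot all_order all_algebra.
From mathcomp Require Import all_classical all_reals all_analysis.
From mathcomp Require Import complex.

Set Implicit Arguments.
Unset Strict Implicit.
Unset Printing Implicit Defensive.

Import Order.TTheory GRing.Theory Num.Theory.
Import numFieldNormedType.Exports.

Local Open Scope classical_set_scope.
Local Open Scope ring_scope.

(* A Hilbert space may be real or complex. *)
Variant scalar_kind := RealScalars | ComplexScalars.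

Definition scalars (R : realType) (k : scalar_kind) : numFieldType :=
  match k with RealScalars => R | ComplexScalars => R[i] end.

Definition scalar_conj (R : realType) (k : scalar_kind) :
    scalars R k -> scalars R k :=
  match k with RealScalars => fun a => a | ComplexScalars => fun a => a^* end.

Definition scalar_re (R : realType) (k : scalar_kind) : scalars R k -> R :=
  match k with RealScalars => fun a => a | ComplexScalars => @complex.Re R end.

Section Hilbert.
Variables (R : realType) (k : scalar_kind).
Variable H : completeNormedModType (scalars R k).
Variable dot : {dot H for @scalar_conj R k}.

(* Together with the completeness of H, this makes (H, dot) a Hilbert space. *)
Definition norm_from_dot := forall x : H, dot x x = `|x| ^+ 2.

Definition closed_subspace (A : set H) :=
  closed A /\ GRing.submod_closed (mem A).

Definition orthogonal_direct_sum (d : nat) (A : 'I_d -> set H) :=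
  (forall i j, i != j -> forall x y, A i x -> A j y -> dot x y = 0) /\
  (forall x, exists2 y : 'I_d -> H, forall i, A i (y i) & x = \sum_(i < d) y i).

Definition orthogonal_projection (A : set H) (E : H -> H) :=
  forall x, A (E x) /\ forall y, A y -> dot (x - E x) y = 0.

(* The norm of H takes its values in the scalar field, hence scalar_re; the
   supremum is +oo when T is not bounded. *)
Definition opnorm (T : H -> H) : \bar R :=
  ereal_sup [set (scalar_re `|T x|)%:E | x in [set x : H | `|x| <= 1]].

Section ArrangementSum.
Variables (L : H -> H) (d : nat) (E : 'I_d -> H -> H).

(* E_{j_1} L E_{j_2} L ... E_{j_{n-1}} L E_{j_n} for s = [:: j_1; ...; j_n] *)
Fixpoint alternating_product (s : seq 'I_d) : H -> H :=
  match s with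
  | [::] => idfun
  | [:: j] => E j
  | j :: s' => E j \o L \o alternating_product s'
  end.

Definition arrangement_sum (n : nat) (m : 'I_d -> nat) (x : H) : H :=
  \sum_(j : n.-tuple 'I_d | [forall i, count_mem i j == m i])
    alternating_product j x.

End ArrangementSum.
End Hilbert.

(* Main.v *)
Require Import Defs.
From HB Require Import structures.
From mathcomp Require Import all_boot all_order all_algebra.
From mathcomp Require Import all_classical all_reals all_analysis.
From mathcomp Require Import complex.

Set Implicit Arguments.
Unset Strict Implicit.
Unset Printing Implicit Defensive.

Import Order.TTheory GRing.Theory Num.Theory.
Import numFieldNormedType.Exports.

Local Open Scope classical_set_scope.
Local Open Scope ring_scope.

(* Give the word j_1 ... j_r the grade e(j_1) + ... + e(j_r) in a finite abelian
   group G, and let w_r(a) be the sum of E_{j_1} L ... L E_{j_r} x over the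
   words of grade a. Then w_{r+1}(a) = \sum_i E_i L w_r(a - e_i) is an orthogonal
   sum, so by Pythagoras, translation in G and Pythagoras again,
     \sum_a |w_{r+1}(a)|^2 = \sum_i \sum_a |E_i L w_r(a)|^2
                          = \sum_a |L w_r(a)|^2 <= |L|^2 \sum_a |w_r(a)|^2.
   Hence \sum_a |w_n(a)|^2 <= |L|^(2(n-1)) |x|^2, which bounds every single
   w_n(a). With G = (Z/N)^d, N > n and e_i the standard basis vectors, the grade
   of a word of length n records its letter multiplicities, so that Kx is one of
   the w_n(a). *)

Lemma big_tupleS (V : nmodType) (T : finType) (r : nat) (P : pred (seq T))
    (F : seq T -> V) :
  \sum_(t : r.+1.-tuple T | P t) F t
  = \sum_i \sum_(t : r.-tuple T | P (i :: t)) F (i :: t).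
Proof.
rewrite pair_big_dep /=.
rewrite (reindex (fun p : T * r.-tuple T => [tuple of p.1 :: p.2])) //=.
exists (fun t : r.+1.-tuple T => (thead t, [tuple of behead t])).
  by move=> [i t] _; congr (_, _); apply: val_inj.
by move=> t _; rewrite /= -tuple_eta.
Qed.

(** * Orthogonal projections and Pythagoras *)

Section OrthogonalSums.
Variables (R : realType) (k : scalar_kind).
Variable H : completeNormedModType (scalars R k).
Variable dot : {dot H for @scalar_conj R k}.
Hypothesis dot_norm : norm_from_dot dot.

(* Rewriting with linearDl etc. leaves [dot] under another coercion to a
   function, on which hypotheses about [dot] no longer rewrite. *)
Lemma dotDl (x y z : H) : dot (x + y) z = dot x z + dot y z.
Proof. exact: linearDl. Qed.

Lemma dotBl (x y z : H) : dot (x - y) z = dot x z - dot y z.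
Proof. exact: linearBl. Qed.

Lemma dot_suml (I : Type) (r : seq I) (P : pred I) (F : I -> H) (z : H) :
  dot (\sum_(i <- r | P i) F i) z = \sum_(i <- r | P i) dot (F i) z.
Proof. exact: linear_sumlz. Qed.

Lemma dot_sumr (I : Type) (r : seq I) (P : pred I) (F : I -> H) (z : H) :
  dot z (\sum_(i <- r | P i) F i) = \sum_(i <- r | P i) dot z (F i).
Proof. exact: linear_sumr. Qed.

Lemma dotxx_eq0 (x : H) : dot x x = 0 -> x = 0.
Proof. by rewrite dot_norm => /eqP; rewrite sqrf_eq0 normr_eq0 => /eqP. Qed.

Lemma sqr_norm_sum_orthogonal (I : finType) (y : I -> H) :
    (forall i j, i != j -> dot (y i) (y j) = 0) ->
  `|\sum_i y i| ^+ 2 = \sum_i `|y i| ^+ 2.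
Proof.
move=> y_orth; rewrite -dot_norm dot_suml; apply: eq_bigr => i _.
rewrite dot_sumr (bigD1 i) //= big1 ?addr0 ?dot_norm // => j ji.
by apply: y_orth; rewrite eq_sym.
Qed.

Variables (d : nat) (A : 'I_d -> set H) (E : 'I_d -> H -> H).
Hypothesis A_closed : forall i, closed_subspace (A i).
Hypothesis A_sum : orthogonal_direct_sum dot A.
Hypothesis E_proj : forall i, orthogonal_projection dot (A i) (E i).

Lemma closed_subspaceD i x y : A i x -> A i y -> A i (x + y).
Proof.
case: (A_closed i) => _ [_ lin] xA yA.
have := lin 1 x y; rewrite scale1r.
by move=> /(_ (mem_set xA) (mem_set yA))/set_mem.
Qed.

Lemma closed_subspaceB i x y : A i x -> A i y -> A i (x - y).
Proof.
case: (A_closed i) => _ [_ lin] xA yA.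
have := lin (-1) y x; rewrite scaleN1r addrC.
by move=> /(_ (mem_set yA) (mem_set xA))/set_mem.
Qed.

(** [E i x - y] lies in [A i] and is also orthogonal to [A i], hence to itself. As [E i] is given
    only as a function, its additivity and the resolution of the identity are both derived from
    this. *)
Lemma projection_unique i x y :
  A i y -> (forall z, A i z -> dot (x - y) z = 0) -> E i x = y.
Proof.
move=> yA xy; have [ExA xE] := E_proj i x.
have DA := closed_subspaceB ExA yA.
apply/eqP; rewrite -subr_eq0; apply/eqP/dotxx_eq0.
have {1}-> : E i x - y = (x - y) - (x - E i x).
  by rewrite opprB addrAC addrCA subrr addr0.
by rewrite dotBl xy // xE // subrr.
Qed.

Lemma projectionD i x y : E i (x + y) = E i x + E i y.
Proof.
have [xA xE] := E_proj i x; have [yA yE] := E_proj i y.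
apply: projection_unique; first exact: closed_subspaceD.
by move=> z zA; rewrite opprD addrACA dotDl xE // yE // addr0.
Qed.

Lemma projection0 i : E i 0 = 0.
Proof. by apply: (@addrI _ (E i 0)); rewrite -projectionD !addr0. Qed.

Lemma projection_sum i (I : Type) (r : seq I) (P : pred I) (F : I -> H) :
  E i (\sum_(j <- r | P j) F j) = \sum_(j <- r | P j) E i (F j).
Proof. exact: (big_morph _ (projectionD i) (projection0 i)). Qed.

Lemma sum_projections x : \sum_i E i x = x.
Proof.
have [A_orth A_dec] := A_sum; have [y yA xE] := A_dec x.
rewrite [RHS]xE; apply: eq_bigr => i _; apply: projection_unique => // z zA.
rewrite xE (bigD1 i) //= addrAC subrr add0r dot_suml big1 // => j ji.
exact: A_orth ji _ _ (yA j) zA.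
Qed.

Lemma projection_orthogonal i j x y : i != j -> dot (E i x) (E j y) = 0.
Proof.
by move=> ij; apply: A_sum.1 ij _ _ _ _; [case: (E_proj i x)|case: (E_proj j y)].
Qed.

Lemma sqr_norm_sum_projections (F : 'I_d -> H) :
  `|\sum_i E i (F i)| ^+ 2 = \sum_i `|E i (F i)| ^+ 2.
Proof.
by apply: sqr_norm_sum_orthogonal => i j; exact: projection_orthogonal.
Qed.

(** Pythagoras turns both sides into double sums of squared norms of projections; for fixed [i], the
    translation by [- e i] merely permutes [G]. *)
Lemma sum_sqr_norm_graded_shift (G : finZmodType) (e : 'I_d -> G) (v : G -> H) :
  \sum_a `|\sum_i E i (v (a - e i))| ^+ 2 = \sum_a `|v a| ^+ 2.
Proof.
under eq_bigr do rewrite sqr_norm_sum_projections.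
rewrite exchange_big /=.
under [RHS]eq_bigr do rewrite -[v _]sum_projections sqr_norm_sum_projections.
rewrite [RHS]exchange_big; apply: eq_bigr => i _ /=.
by rewrite [RHS](reindex_inj (@addIr _ (- e i))).
Qed.

(** * Sums over the words of a given grade *)

Variables (L : {linear H -> H}) (M : scalars R k).
Hypothesis M_ge0 : 0 <= M.
Hypothesis L_le : forall x, `|L x| <= M * `|x|.
Variables (G : finZmodType) (e : 'I_d -> G).

(** This is w_r(a) of the overview. *)
Definition graded_sum (r : nat) (a : G) (x : H) : H :=
  \sum_(t : r.-tuple 'I_d | \sum_(i <- t) e i == a) alternating_product L E t x.

Lemma graded_sumS (r : nat) (a : G) (x : H) :
  graded_sum r.+2 a x = \sum_i E i (L (graded_sum r.+1 (a - e i) x)).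
Proof.
rewrite /graded_sum (@big_tupleS _ _ _ (fun s => \sum_(i <- s) e i == a)
  (fun s => alternating_product L E s x)).
apply: eq_bigr => i _; rewrite linear_sum projection_sum.
apply: eq_big => t; first by rewrite big_cons addrC eq_sym -subr_eq eq_sym.
(* [alternating_product] puts an [L] after the first letter only if the tail is nonempty, as it is
   here. *)
by case: t => -[|j s].
Qed.

(** The one-letter case takes the same shifted form as the recursion, with [x] placed in grade 0, so
    that the norm identity for shifts applies to it too. *)
Lemma graded_sum1 (a : G) (x : H) :
  graded_sum 1 a x = \sum_i E i (if a - e i == 0 then x else 0).
Proof.
rewrite /graded_sum (@big_tupleS _ _ _ (fun s => \sum_(i <- s) e i == a)
  (fun s => alternating_product L E s x)).
apply: eq_bigr => i _.
rewrite big_mkcond (big_pred1 [tuple]) => [|t]; last exact/esym/eqP/tuple0.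
rewrite /= big_seq1 subr_eq0 eq_sym.
by case: ifP; rewrite ?projection0.
Qed.

Lemma sum_sqr_norm_graded_sum (r : nat) (x : H) :
  \sum_a `|graded_sum r.+1 a x| ^+ 2 <= M ^+ r ^+ 2 * `|x| ^+ 2.
Proof.
elim: r => [|r IH].
  under eq_bigr do rewrite graded_sum1.
  rewrite (sum_sqr_norm_graded_shift e (fun a => if a == 0 then x else 0)).
  rewrite (bigD1 0) //= eqxx big1 ?addr0 ?expr0 ?expr1n ?mul1r // => a /negPf->.
  by rewrite normr0 expr0n.
under eq_bigr do rewrite graded_sumS.
rewrite (sum_sqr_norm_graded_shift e (fun a => L (graded_sum r.+1 a x))).
(* The bound on [L] is applied in each grade separately. *)
apply: (@le_trans _ _ (M ^+ 2 * \sum_a `|graded_sum r.+1 a x| ^+ 2)).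
  rewrite mulr_sumr; apply: ler_sum => a _.
  by rewrite -exprMn ler_sqr ?nnegrE ?mulr_ge0.
by rewrite (exprS M r) exprMn -[leRHS]mulrA ler_wpM2l // exprn_ge0.
Qed.

Lemma graded_sum_le (r : nat) (a : G) (x : H) :
  `|graded_sum r.+1 a x| <= M ^+ r * `|x|.
Proof.
rewrite -ler_sqr ?nnegrE ?mulr_ge0 ?exprn_ge0 // exprMn.
apply: le_trans (sum_sqr_norm_graded_sum r x).
by rewrite (bigD1 a) //= lerDl sumr_ge0 // => b _; rewrite exprn_ge0.
Qed.

End OrthogonalSums.

(** Coordinate [i] of the grade is the residue of the number of occurrences of [i]. Both this number
    and [m i] are at most [n], which is below the modulus, so equal residues mean equal numbers. *)
Lemma count_mem_mod (d n N : nat) (m : 'I_d -> nat) (t : n.-tuple 'I_d) :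
    n = (\sum_(i < d) m i)%N -> (n < N.+2)%N ->
  [forall i, count_mem i t == m i] =
  (\sum_(i <- t) delta_mx 0 i == \row_i (m i)%:R :> 'rV['Z_N.+2]_d).
Proof.
move=> n_sum nN.
have entry i : (\sum_(j <- t) delta_mx 0 j : 'rV['Z_N.+2]_d) 0 i
    = (count_mem i t)%:R.
  rewrite summxE -sum1_count natr_sum big_mkcond [RHS]big_mkcond /=.
  by apply: eq_bigr => j _; rewrite mxE eqxx /= eq_sym; case: eqP.
have natr_inj (a b : nat) : (a <= n)%N -> (b <= n)%N ->
    a%:R = b%:R :> 'Z_N.+2 -> a = b.
  move=> an bn /(congr1 val); rewrite /= !Zp_nat /=.
  by rewrite !modn_small // (leq_ltn_trans _ nN).
apply/forallP/eqP => [tm|tm i].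
  by apply/rowP => i; rewrite entry mxE (eqP (tm i)).
apply/eqP/natr_inj; first by rewrite -[leqRHS](size_tuple t) count_size.
  by rewrite n_sum (bigD1 i) //= leq_addr.
by rewrite -entry tm mxE.
Qed.

(** * Operator norms and real scalars *)

Section Opnorm.
Variables (R : realType) (k : scalar_kind).

(** Norms of vectors are scalars while [opnorm] is real-valued or infinite; this embedding carries
    real bounds back to the scalar field. *)
Definition scalar_of_real (c : R) : scalars R k :=
  match k return scalars R k with
  | RealScalars => c
  | ComplexScalars => c%:C%C
  end.

Lemma scalar_of_realK (c : scalars R k) :
  0 <= c -> scalar_of_real (scalar_re c) = c.
Proof.
rewrite /scalar_of_real; case: k c => //= -[a b] /=.
by rewrite lecE /= => /andP[/eqP -> _].
Qed.

Lemma scalar_of_realX (a : R) n :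
  scalar_of_real (a ^+ n) = scalar_of_real a ^+ n.
Proof. by rewrite /scalar_of_real; case: k => //; rewrite rmorphXn. Qed.

Lemma ler_scalar_of_real (a b : R) :
  (scalar_of_real a <= scalar_of_real b) = (a <= b).
Proof. by rewrite /scalar_of_real; case: k => //; rewrite lecR. Qed.

Lemma scalar_of_real_ge0 (a : R) : (0 <= scalar_of_real a) = (0 <= a).
Proof.
rewrite -[in RHS]ler_scalar_of_real; congr (_ <= _).
by rewrite /scalar_of_real; case: k.
Qed.

Variable H : completeNormedModType (scalars R k).

Lemma opnorm_ge0 (T : H -> H) : (0 <= opnorm T)%E.
Proof.
apply: (@le_trans _ _ (scalar_re `|T 0|)%:E).
  by rewrite lee_fin -scalar_of_real_ge0 scalar_of_realK.
by apply: ereal_sup_ubound; exists 0 => //=; rewrite normr0 ler01.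
Qed.

Lemma norm_le_opnorm (L : {linear H -> H}) (x : H) : opnorm L \is a fin_num ->
  `|L x| <= scalar_of_real (fine (opnorm L)) * `|x|.
Proof.
(* A nonzero [x] is rescaled to a unit vector, which belongs to the set defining the supremum. *)
move=> Lfin; have [->|x0] := eqVneq x 0.
  by rewrite linear0 !normr0 mulr0.
have nx : 0 < `|x| by rewrite normr_gt0.
rewrite -ler_pdivrMr //.
have -> : `|L x| / `|x| = `|L (`|x|^-1 *: x)|.
  by rewrite linearZ normrZ normfV normr_id mulrC.
rewrite -[leLHS]scalar_of_realK // ler_scalar_of_real -lee_fin fineK //.
apply: ereal_sup_ubound; exists (`|x|^-1 *: x) => //=.
by rewrite normrZ normfV normr_id mulVf // gt_eqF.
Qed.

Lemma opnorm_le (T : H -> H) (c : R) :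
  (forall x, `|x| <= 1 -> `|T x| <= scalar_of_real c) -> (opnorm T <= c%:E)%E.
Proof.
move=> Tc; apply: ub_ereal_sup => _ [x /= x1 <-].
by rewrite lee_fin -ler_scalar_of_real scalar_of_realK // Tc.
Qed.

End Opnorm.

Theorem lemma8 (R : realType) (k : scalar_kind)
    (H : completeNormedModType (scalars R k))
    (dot : {dot H for @scalar_conj R k}) (dot_norm : norm_from_dot dot)
    (L : {linear H -> H}) (L_bounded : bounded_near L (nbhs (0 : H)))
    (d : nat) (A : 'I_d -> set H)
    (A_closed : forall i, closed_subspace (A i))
    (A_sum : orthogonal_direct_sum dot A)
    (E : 'I_d -> H -> H)
    (E_proj : forall i, orthogonal_projection dot (A i) (E i))
    (n : nat) (m : 'I_d -> nat) (n_sum : n = (\sum_(i < d) m i)%N)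
    (n_ge2 : (2 <= n)%N) :
  (opnorm (arrangement_sum L E n m) <= opnorm L ^+ n.-1)%E.
Proof.
have [Lfin|] := boolP (opnorm L \is a fin_num); last first.
  (* If [opnorm L] is infinite, so is the right-hand side, because the exponent [n.-1] is
     positive. *)
  rewrite ge0_fin_numE ?opnorm_ge0 // -leNgt leye_eq => /eqP->.
  have yX p : (+oo ^+ p.+1 = +oo :> \bar R)%E.
    by elim: p => [|p IH]; rewrite expeS ?expe0 ?mule1 // IH mulyy.
  by rewrite -(prednK (_ : 0 < n.-1)%N) ?yX ?leey // -subn1 subn_gt0.
set c := fine (opnorm L).
have c0 : 0 <= c by rewrite fine_ge0 ?opnorm_ge0.
rewrite -(fineK Lfin) -EFin_expe; apply: opnorm_le => x x1.
have [N nN] : exists N, (n < N.+2)%N by exists n.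
(* The grade shared by exactly the arrangements in the sum. *)
pose a : 'rV['Z_N.+2]_d := \row_i (m i)%:R.
have -> : arrangement_sum L E n m x =
    graded_sum E L (fun i => delta_mx 0 i) n a x.
  by apply: eq_bigl => t; apply: count_mem_mod.
rewrite -[X in graded_sum _ _ _ X](prednK (ltnW n_ge2)).
have Mge0 : 0 <= scalar_of_real k c by rewrite scalar_of_real_ge0.
apply: le_trans (graded_sum_le dot_norm A_closed A_sum E_proj Mge0 _ _ _ _ _) _.
  by move=> y; exact: norm_le_opnorm.
(* The remaining factor, the norm of [x], is at most 1. *)
by rewrite scalar_of_realX ler_piMr ?exprn_ge0.
Qed.
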